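(* Let $\mathcal N,\tilde{\mathcal N}$ be arbitrary admissible algebras over $\mathbb F$, not necessarily of the same dimension, with $\dim(\tilde{\mathcal N})>1$. Let $\pi\in\Pi(\mathcal N)$ and $\tilde\pi\in\Pi(\tilde{\mathcal N})$ be arbitrary admissible projections and put $S:=S_\pi\subset\mathcal N$, $\tilde S:=S_{\tilde\pi}\subset\tilde{\mathcal N}$. Then for every linear map $L:\mathcal N\to\tilde{\mathcal N}$ the following conditions are equivalent: (i) $L$ is an algebra isomorphism. (ii) $\tilde S=L(S-c)$ for some $c\in\mathcal N$. Furthermore, the point $c=c_{L,\pi,\tilde\pi}$ in (ii) is uniquely determined by $L,\pi,\tilde\pi$ and coincides with the unique element $c\in S$ satisfying $\tilde\pi=L\circ(\pi\circ M_{\exp c})\circ L^{-1}$. Finally, $$S=\{c_{L,\pi,\rho}:\rho\in\Pi(\tilde{\mathcal N})\}$$ holds for every algebra isomorphism $L:\mathcal N\to\tilde{\mathcal N}$.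
   Context: $\mathbb F$ is a field of characteristic $0$; all algebras are associative $\mathbb F$-algebras. An algebra $\mathcal N$ is nilpotent if $\mathcal N^{k+1}=0$ for some $k$, where $\mathcal N^1=\mathcal N$ and $\mathcal N^{k+1}$ is the linear span of $\mathcal N\mathcal N^k$. The annihilator of a commutative algebra $\mathcal N$ is $\mathcal N_{[1]}=\{x\in\mathcal N: x\mathcal N=0\}$. An admissible algebra is a commutative nilpotent algebra of finite dimension over $\mathbb F$ whose annihilator $\mathcal N_{[1]}$ has dimension $1$. An admissible projection on $\mathcal N$ is a linear map $\pi=\pi^2\in\mathrm{End}(\mathcal N)$ with range $\pi(\mathcal N)=\mathcal N_{[1]}$; $\Pi(\mathcal N)$ is the set of all admissible projections on $\mathcal N$. Put $\exp_1(x)=\sum_{k\ge1}x^k/k!$ for $x\in\mathcal N$ (a finite sum) and $S_\pi:=\{x\in\mathcal N:\pi(\exp_1 x)=0\}$. Let $\mathcal N^0=\mathbb F\cdot\mathbf 1\oplus\mathcal N$ be the unital extension of $\mathcal N$, $\exp(x)=\mathbf 1+\exp_1(x)\in\mathcal N^0$ for $x\in\mathcal N$, and for $e\in\mathcal N^0$ let $M_e\in\mathrm{End}(\mathcal N)$ be the multiplication operator $M_e(x)=ex$. For a set $S$ and a vector $c$, $S-c=\{s-c:s\in S\}$. *)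

(* Defs.v *)
From HB Require Import structures.
From mathcomp Require Import all_boot all_order all_algebra.
From mathcomp Require Import boolp classical_sets.

Set Implicit Arguments.
Unset Strict Implicit.
Unset Printing Implicit Defensive.
Import GRing.Theory.
Local Open Scope ring_scope.

(* Associative algebras need not be unital here, hence MathComp's algType and
   falgType (whose rings contain 1) do not apply. *)
HB.mixin Record Vector_isCommNonunital (F : fieldType) V of Vector F V := {
  nmul : V -> V -> V;
  nmulA : associative nmul;
  nmulC : commutative nmul;
  nmulDl : left_distributive nmul +%R;
  nmulZl : forall (a : F) (x y : V), nmul (a *: x) y = a *: nmul x y
}.

#[short(type="commNonunitalAlgType")]
HB.structure Definition CommNonunitalAlg (F : fieldType) :=
  {V of Vector F V & Vector_isCommNonunital F V}.

Section Algebra.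
Context {F : fieldType} {N : commNonunitalAlgType F}.
Implicit Types (x y z : N) (U W : {vspace N}).

Lemma nmulDr x y z : nmul x (y + z) = nmul x y + nmul x z.
Proof. by rewrite ![nmul x _]nmulC nmulDl. Qed.

Lemma nmulZr (a : F) x y : nmul x (a *: y) = a *: nmul x y.
Proof. by rewrite ![nmul x _]nmulC nmulZl. Qed.

Lemma nmul_linear x : linear (@nmul F N x).
Proof. by move=> a y z; rewrite nmulDr nmulZr. Qed.
HB.instance Definition _ x :=
  GRing.isLinear.Build F N N _ (@nmul F N x) (nmul_linear x).

Definition lmulop x : 'End(N) := linfun (nmul x).

Lemma lmulopE x y : lmulop x y = nmul x y.
Proof. exact: lfunE. Qed.

Lemma lmulop_linear : linear lmulop.
Proof.
move=> a x y; apply/lfunP => z.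
by rewrite add_lfunE scale_lfunE !lmulopE nmulDl nmulZl.
Qed.
HB.instance Definition _ :=
  GRing.isLinear.Build F N 'End(N) _ lmulop lmulop_linear.

(* span of all products of an element of U and an element of W *)
Definition nprodv U W : {vspace N} := <<allpairs nmul (vbasis U) (vbasis W)>>%VS.

Lemma memv_nprod U W x y : x \in U -> y \in W -> nmul x y \in nprodv U W.
Proof.
move=> /coord_vbasis-> /coord_vbasis->.
rewrite linear_sum; apply: memv_suml => j _ /=.
rewrite nmulC linear_sum; apply: memv_suml => i _ /=.
rewrite nmulC nmulZr nmulZl !memvZ // memv_span //.
by apply: allpairs_f; apply: mem_nth; rewrite size_tuple.
Qed.

Lemma nprodvP {U W} {Z : {vspace N}} :
  reflect (forall x y, x \in U -> y \in W -> nmul x y \in Z)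
          (nprodv U W <= Z)%VS.
Proof.
apply: (iffP idP) => [sUWZ x y Ux Wy|sUWZ].
  exact: (subvP sUWZ) _ (memv_nprod Ux Wy).
apply/span_subvP=> _ /allpairsP[[x y] /= [Ux Wy ->]].
by apply: sUWZ; rewrite ?vbasis_mem.
Qed.

(* N^k for k >= 1 *)
Definition powv (k : nat) : {vspace N} := iter k.-1 (nprodv fullv) fullv.

Definition nilpotent : Prop := exists k : nat, powv k.+1 = 0%VS.

Definition annihilator : {vspace N} := lker (linfun lmulop).

Lemma annihilatorP x : reflect (forall y, nmul x y = 0) (x \in annihilator).
Proof.
rewrite memv_ker lfunE /=; apply: (iffP eqP) => [x0 y|x0].
  by rewrite -lmulopE x0 zero_lfunE.
by apply/lfunP => y; rewrite lmulopE x0 zero_lfunE.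
Qed.

Definition admissible : Prop := nilpotent /\ \dim annihilator = 1%N.

Definition admissible_projections : set 'End(N) :=
  [set pi : 'End(N) | (pi \o pi)%VF = pi /\ limg pi = annihilator]%classic.

(* x^k for k >= 1 *)
Definition npow x (k : nat) : N := iter k.-1 (nmul x) x.

(* In a nilpotent algebra x^k = 0 for k > dim N, so this is the full series;
   see exp1E. *)
Definition exp1 x : N :=
  \sum_(1 <= k < (\dim {:N}).+1) (k`!%:R : F)^-1 *: npow x k.

Lemma powvS k : powv k.+2 = nprodv fullv (powv k.+1).
Proof. by []. Qed.

Lemma powvSS k : (powv k.+2 <= powv k.+1)%VS.
Proof.
elim: k => [|k IH]; first exact: subvf.
rewrite powvS [powv k.+2]powvS; apply/nprodvP => x y xN yk.
by apply: memv_nprod => //; apply: (subvP IH).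
Qed.

Lemma powv_stable k m : powv k.+2 = powv k.+1 -> powv (k + m).+1 = powv k.+1.
Proof.
move=> e; elim: m => [|m IH]; first by rewrite addn0.
by rewrite addnS powvS IH -powvS.
Qed.

Lemma powv_dim k : nilpotent -> powv k.+1 != 0%VS -> (\dim (powv k.+1) + k <= \dim {:N})%N.
Proof.
case=> n n0; elim: k => [|k IH] k0; first by rewrite addn0.
have k0' : powv k.+1 != 0%VS.
  by apply: contra k0 => /eqP e; have := powvSS k; rewrite e subv0.
apply: leq_trans (IH k0'); rewrite addnS ltn_add2r.
rewrite ltn_neqAle dimvS ?powvSS // andbT.
apply: contra k0' => /eqP ed.
have e : powv k.+2 = powv k.+1.
  by apply/eqP; rewrite eqEdim powvSS ed leqnn.
have := powv_stable n e.
have zS j : powv (n + j).+1 = 0%VS.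
  elim: j => [|j IHj]; first by rewrite addn0.
  by apply/eqP; rewrite -subv0 -IHj addnS powvSS.
by rewrite addnC zS => <-.
Qed.

Lemma npow_mem x k : npow x k \in powv k.
Proof.
case: k => [|k]; first exact: memvf.
elim: k => [|k IH]; first exact: memvf.
by rewrite powvS; apply: memv_nprod IH; apply: memvf.
Qed.

Lemma npow_eq0 x k : nilpotent -> (\dim {:N} < k)%N -> npow x k = 0.
Proof.
case: k => // k nN; rewrite ltnS => lek.
have [e|k0] := eqVneq (powv k.+1) 0%VS.
  by apply/eqP; rewrite -memv0 -e npow_mem.
have := leq_trans (powv_dim nN k0) lek.
by rewrite -[X in (_ <= X)%N]add0n leq_add2r leqn0 dimv_eq0 (negbTE k0).
Qed.

Lemma exp1E x n : nilpotent -> (\dim {:N} <= n)%N ->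
  exp1 x = \sum_(1 <= k < n.+1) (k`!%:R : F)^-1 *: npow x k.
Proof.
move=> nN len; rewrite [RHS](big_cat_nat (ltn0Sn _) (len : (_.+1 <= n.+1)%N)) /=.
rewrite [X in _ + X]big_nat [X in _ + X]big1 ?addr0 // => k /andP[ltk _].
by rewrite npow_eq0 // scaler0.
Qed.

Definition Sset (pi : 'End(N)) : set N := [set x | pi (exp1 x) = 0]%classic.

(* The unital extension F.1 (+) N: the pair (a, x) stands for a.1 + x. *)
Definition unital_ext : Type := (F * N)%type.

Definition uext_mul (e f : unital_ext) : unital_ext :=
  (e.1 * f.1, e.1 *: f.2 + f.1 *: e.2 + nmul e.2 f.2).

Definition uext_in x : unital_ext := (0, x).

Definition uexp x : unital_ext := (1, exp1 x).

Definition mulop_fun (e : unital_ext) x : N := (uext_mul e (uext_in x)).2.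

Lemma mulop_funE e x : uext_mul e (uext_in x) = uext_in (mulop_fun e x).
Proof. by rewrite /uext_mul /uext_in /= mulr0. Qed.

Lemma mulop_fun_linear e : linear (mulop_fun e).
Proof.
move=> a x y; rewrite /mulop_fun /= !scale0r !addr0 nmulDr nmulZr.
by rewrite !scalerDr !scalerA [e.1 * a]mulrC addrACA.
Qed.
HB.instance Definition _ e :=
  GRing.isLinear.Build F N N _ (mulop_fun e) (mulop_fun_linear e).

Definition mulop (e : unital_ext) : 'End(N) := linfun (mulop_fun e).

Lemma mulopE e x : uext_in (mulop e x) = uext_mul e (uext_in x).
Proof. by rewrite mulop_funE lfunE. Qed.

Definition translate (S : set N) (c : N) : set N := [set s - c | s in S]%classic.

End Algebra.

Arguments powv {F} N k.
Arguments nilpotent {F} N.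
Arguments annihilator {F} N.
Arguments admissible {F} N.
Arguments admissible_projections {F} N.
Arguments unital_ext {F} N.

Section Morphism.
Context {F : fieldType} {N Nt : commNonunitalAlgType F}.

Definition alg_iso (L : 'Hom(N, Nt)) : Prop :=
  bijective L /\ (forall x y : N, L (nmul x y) = nmul (L x) (L y)).

Definition matching_points (L : 'Hom(N, Nt)) (pi : 'End(N)) (rho : 'End(Nt)) :
    set N :=
  [set c | Sset rho = (L @` translate (Sset pi) c)%classic]%classic.

(* the point c_(L, pi, rho), with the junk value 0 if there is none *)
Definition cpoint (L : 'Hom(N, Nt)) (pi : 'End(N)) (rho : 'End(Nt)) : N :=
  xget 0 (matching_points L pi rho).

End Morphism.

(* Main.v *)
Require Import Defs.
From HB Require Import structures.
From mathcomp Require Import all_boot all_order all_algebra.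
From mathcomp Require Import boolp classical_sets.
From mathcomp Require Import ring.
Import GRing.Theory.
Local Open Scope ring_scope.
Local Open Scope classical_set_scope.
Set Implicit Arguments.
Unset Strict Implicit.

(** Fix a generator [w] of the annihilator and write [pi x = phi x *: w], so that
    [Sset pi] is the zero set of [f x = phi (exp1 x)] and [f (x + t w) = f x + t].

    (i) => (ii): the form [phi (x y)] has radical [annihilator N], so every linear
    form [psi] with [psi w = 1] is [phi (a x)] with [a] in [1 + N]; writing
    [a = exp c] with [f c = 0], one gets [psi (exp1 x) = f (x + c)], i.e. the zero
    set of [psi o exp1] is [Sset pi - c]. This is applied to the form of
    [L^-1 pit L]. The zero set determines the projection, as
    [f] vanishes at [x - f x w]; this gives uniqueness of [c].

    (ii) => (i): one may assume [c = 0] after replacing [pi]. Since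
    [f' y = phi' (exp1 y)] on [Nt] has a nonzero quadratic part, [Sset pit] spans,
    so [L] is onto; an element of the kernel would be a period of [f], so
    [L] is injective. Then [f] and [f' o L] have the same zeros and slope one in
    some direction, hence are proportional polynomials. Comparing the homogeneous
    parts of degree 1, 2, 3 and polarizing, [L] preserves up to a common factor
    [phi x], [phi (x y)] and [phi (x y z)], and these determine the product. *)

(** * Polynomial functions over an infinite field *)

Section PolynomialFunctions.
Variable F : fieldType.
Hypothesis charF : [pchar F] =i pred0.

(** In characteristic 0 the naturals are distinct in [F], so such a [p] has [size p] different
    roots, one too many for a nonzero polynomial. *)
Lemma poly_fun0 (p : {poly F}) : (forall t, p.[t] = 0) -> p = 0.
Proof.
move=> p0; apply/eqP; apply: contraT => pN0.
have inj : injective (fun i : nat => i%:R : F).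
  move=> i j; wlog leij : i j / (i <= j)%N.
    by move=> H /[dup] e; case: (leqP i j) => [/H|/ltnW/H h _]; [apply | rewrite h].
  move/eqP; rewrite eq_sym -subr_eq0 -natrB // ((pcharf0P F).1 charF) subn_eq0 => leji.
  by apply/eqP; rewrite eqn_leq leij leji.
have := @max_poly_roots _ p [seq i%:R | i <- iota 0 (size p)] pN0.
rewrite size_map size_iota ltnn => -> //; last by rewrite map_inj_uniq ?iota_uniq.
by apply/allP => _ /mapP[i _ ->]; rewrite /root p0.
Qed.

(** Along the line of all [t *: x], this separates the homogeneous parts of [h (exp1 x)]. *)
Lemma coef_fun_inj n (a b : nat -> F) :
  (forall t, \sum_(1 <= k < n.+1) t ^+ k * a k = \sum_(1 <= k < n.+1) t ^+ k * b k) ->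
  forall k, (0 < k <= n)%N -> a k = b k.
Proof.
move=> e k /andP[k0 kn].
pose p : {poly F} := \sum_(1 <= i < n.+1) (a i - b i) *: 'X^i.
have p0 : p = 0.
  apply: poly_fun0 => t; rewrite horner_sum.
  transitivity (\sum_(1 <= i < n.+1) (t ^+ i * a i - t ^+ i * b i)).
    by apply: eq_bigr => i _; rewrite hornerZ hornerXn mulrC mulrBr.
  by rewrite sumrB e subrr.
have : p`_k = 0 by rewrite p0 coef0.
rewrite coef_sum (bigD1_seq k) ?mem_index_iota ?iota_uniq ?k0 ?ltnS //=.
rewrite coefZ coefXn eqxx mulr1 big1 ?addr0; first by move/subr0_eq.
by move=> i ik; rewrite coefZ coefXn eq_sym (negbTE ik) mulr0.
Qed.

Section OnVectorSpace.
Variable V : vectType F.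

Inductive polyfun : (V -> F) -> Prop :=
| PolyfunConst c : polyfun (fun=> c)
| PolyfunScalar (h : {scalar V}) : polyfun h
| PolyfunAdd f g : polyfun f -> polyfun g -> polyfun (fun x => f x + g x)
| PolyfunMul f g : polyfun f -> polyfun g -> polyfun (fun x => f x * g x).

Lemma polyfun_sum I (r : seq I) (f : I -> V -> F) :
  (forall i, polyfun (f i)) -> polyfun (fun x => \sum_(i <- r) f i x).
Proof.
move=> pf; elim: r => [|i r IH].
  rewrite (_ : (fun _ => _) = fun=> 0); first exact: PolyfunConst.
  by apply/funext => x; rewrite big_nil.
rewrite (_ : (fun _ => _) = fun x => f i x + \sum_(j <- r) f j x).
  exact: PolyfunAdd.
by apply/funext => x; rewrite big_cons.
Qed.

(** The outer variable of [P] is the coordinate along [w], the inner one is [t]. Letting [r] depend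
    on [t] allows one to speak of roots of [P] in F[t]. *)
Lemma polyfun_plane f (a b w : V) : polyfun f ->
  exists P : {poly {poly F}},
    forall (r : {poly F}) t, f (a + t *: b + r.[t] *: w) = P.[r].[t].
Proof.
elim=> [c|h|g h _ [P eP] _ [Q eQ]|g h _ [P eP] _ [Q eQ]].
- by exists c%:P%:P => r t; rewrite !hornerC.
- exists ((h w)%:P *: 'X + ((h a)%:P + h b *: 'X)%:P) => r t.
  rewrite !hornerE !linearD !linearZ /=.
  by ring.
- by exists (P + Q) => r t; rewrite eP eQ !hornerD.
- by exists (P * Q) => r t; rewrite eP eQ !hornerM.
Qed.

Lemma polyfun_line f (a b : V) : polyfun f ->
  exists p : {poly F}, forall t, f (a + t *: b) = p.[t].
Proof.
case/(polyfun_plane a b 0) => P eP; exists P.[0] => t.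
by rewrite -eP scaler0 addr0.
Qed.

(** Join a point where [f] is nonzero to an arbitrary [b] by a line, and use that F[t] is a
    domain. *)
Lemma polyfun_mul_eq0 f g : polyfun f -> polyfun g ->
  (forall x, f x * g x = 0) -> (forall x, f x = 0) \/ (forall x, g x = 0).
Proof.
move=> pf pg fg0; case: (pselect (forall x, f x = 0)) => [|/existsNP[a /eqP fa]].
  by left.
right=> b; have [p ep] := polyfun_line a (b - a) pf.
have [q eq] := polyfun_line a (b - a) pg.
have /eqP : p * q = 0 by apply: poly_fun0 => t; rewrite hornerM -ep -eq.
rewrite mulf_eq0 => /orP[]/eqP r0.
  by move: (ep 0); rewrite r0 horner0 scale0r addr0 => e; rewrite e eqxx in fa.
by move: (eq 1); rewrite r0 horner0 scale1r addrC subrK.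
Qed.

(* [g (x - s w)] is a polynomial in [s] that vanishes at [s = f x], so [s - f x]
   divides it; then put [s = 0]. *)
Lemma polyfun_dvd (f g : V -> F) (w a b : V) : polyfun f -> polyfun g ->
  (forall x t, f (x + t *: w) = f x + t) -> (forall x, f x = 0 -> g x = 0) ->
  forall p q : {poly F}, (forall t, f (a + t *: b) = p.[t]) ->
    (forall t, g (a + t *: b) = q.[t]) -> p %| q.
Proof.
move=> pf pg fw fg p q ep eq; have [P eP] := polyfun_plane a b w pg.
have /factor_theorem[Q eQ] : root P (- p).
  apply/rootP/poly_fun0 => t.
  by rewrite -eP hornerN fg ?fw ?ep ?subrr.
suff -> : q = Q.[0] * p by apply: dvdp_mull.
apply/eqP; rewrite -subr_eq0; apply/eqP/poly_fun0 => t.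
rewrite hornerD hornerN -eq.
have := eP 0 t; rewrite horner0 scale0r addr0 => ->.
by rewrite eQ !hornerE opprK subrr.
Qed.

(** On every line through a fixed [a] with [f a != 0] the two restrictions divide each other by
    [polyfun_dvd], so they differ by a constant factor, which the values at [a] determine. *)
Lemma polyfun_eq_zeros (f g : V -> F) (w v : V) : polyfun f -> polyfun g ->
  (forall x t, f (x + t *: w) = f x + t) ->
  (forall x t, g (x + t *: v) = g x + t) ->
  (forall x, f x = 0 <-> g x = 0) ->
  exists2 q, q != 0 & forall x, g x = q * f x.
Proof.
move=> pf pg fw gv fg0.
have fg x := (fg0 x).1; have gf x := (fg0 x).2.
have [a fa] : exists a, f a != 0.
  exists ((1 - f 0) *: w); rewrite -[_ *: w]add0r fw addrC subrK.
  exact: oner_neq0.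
exists (g a / f a).
  rewrite mulf_neq0 ?invr_eq0 //.
  by apply: contra fa => /eqP/gf->.
move=> b; have [p ep] := polyfun_line a (b - a) pf.
have [q eq] := polyfun_line a (b - a) pg.
have pq := polyfun_dvd pf pg fw fg ep eq.
have qp := polyfun_dvd pg pf gv gf eq ep.
have /eqpf_eq[c c0 ec] : q %= p by rewrite /eqp pq qp.
have e t : g (a + t *: (b - a)) = c * f (a + t *: (b - a)).
  by rewrite ep eq ec hornerZ.
move: (e 0) (e 1); rewrite scale0r addr0 scale1r addrC subrK => -> ->.
by rewrite mulfK.
Qed.

End OnVectorSpace.

Lemma polyfun_affine (V W : vectType F) (L : 'Hom(V, W)) (v : W) (f : W -> F) :
  polyfun f -> polyfun (fun x => f (L x + v)).
Proof.
elim=> [c|h|g h _ pg _ ph|g h _ pg _ ph].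
- exact: PolyfunConst.
- rewrite (_ : (fun _ => _) = fun x => (h \o L) x + h v).
    by apply: PolyfunAdd; [exact: PolyfunScalar | exact: PolyfunConst].
  by apply/funext => x; rewrite linearD.
- exact: PolyfunAdd pg ph.
- exact: PolyfunMul pg ph.
Qed.

Section Polarization.
Variable V : zmodType.

Lemma polarize2 (B : V -> V -> F) :
  (forall x y z, B (x + y) z = B x z + B y z) -> (forall x y, B x y = B y x) ->
  (forall x, B x x = 0) -> forall x y, B x y = 0.
Proof.
move=> BD BC B0 x y; have := B0 (x + y).
rewrite BD ![B _ (x + y)]BC !BD !B0 add0r addr0 [B y x]BC -mulr2n.
by move/eqP; rewrite -mulr_natr mulf_eq0 ((pcharf0P F).1 charF) orbF => /eqP.
Qed.

(** The cubes at [x + y] and [x - y] add up to [6%:R * T x y y]; then [polarize2] applies to the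
    form [T x]. *)
Lemma polarize3 (T : V -> V -> V -> F) :
  (forall x y z t, T (x + y) z t = T x z t + T y z t) ->
  (forall x y z, T x y z = T y x z) -> (forall x y z, T x y z = T x z y) ->
  (forall x, T x x x = 0) -> forall x y z, T x y z = 0.
Proof.
move=> TD TC TC' T0 x.
have TD2 y z s t : T s (y + z) t = T s y t + T s z t.
  by rewrite TC TD ![T _ s _]TC.
have TD3 y z s t : T s t (y + z) = T s t y + T s t z by rewrite TC' TD2 ![T s _ t]TC'.
have T00 s t : T 0 s t = 0.
  by apply: (addrI (T 0 s t)); rewrite -TD !addr0.
have TN y s t : T (- y) s t = - T y s t.
  by apply/eqP; rewrite -addr_eq0 -TD addNr T00.
apply: polarize2 => [y z t|y z|y]; [exact: TD2 | exact: TC' |].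
have N2 s t : T s (- y) t = - T s y t by rewrite TC TN TC.
have N3 s t : T s t (- y) = - T s t y by rewrite TC' N2 TC'.
have e1 : T (x + y) (x + y) (x + y) = 3%:R * (T x x y + T x y y).
  rewrite !(TD, TD2, TD3) !T0 [T y x x]TC
    [T x y x]TC' [T y x y]TC [T y y x]TC' [T y x y]TC.
  by ring.
have e2 : T (x - y) (x - y) (x - y) = 3%:R * (T x y y - T x x y).
  rewrite !(TD, TD2, TD3, TN, N2, N3) !T0 [T y x x]TC
    [T x y x]TC' [T y x y]TC [T y y x]TC' [T y x y]TC.
  by ring.
have : 6%:R * T x y y = 0.
  rewrite -[RHS](addr0 0) -{1}(T0 (x + y)) -(T0 (x - y)) e1 e2; ring.
by move/eqP; rewrite mulf_eq0 ((pcharf0P F).1 charF) => /eqP.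
Qed.

End Polarization.
End PolynomialFunctions.

(** * The exponential is multiplicative *)

Section TruncatedExponential.
Variables (F : fieldType) (A : comAlgType F).
Hypothesis charF : [pchar F] =i pred0.

Lemma fact_neq0 k : k`!%:R != 0 :> F.
Proof. by rewrite ((pcharf0P F).1 charF) -lt0n fact_gt0. Qed.

Definition texp n (x : A) : A := \sum_(0 <= k < n) (k`!%:R : F)^-1 *: x ^+ k.

(** The left side sums over the triangle [i + j < n], the right side over the square [i, j < n].
    Outside the triangle [i + j >= n >= d + d], so [i >= d] or [j >= d] and the term vanishes. *)
Lemma texpD d n (x y : A) : x ^+ d = 0 -> y ^+ d = 0 -> (d + d <= n)%N ->
  texp n (x + y) = texp n x * texp n y.
Proof.
move=> xd yd dn.
have exp0 (z : A) k : z ^+ d = 0 -> (d <= k)%N -> z ^+ k = 0.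
  by move=> zd dk; rewrite -(subnK dk) exprD zd mulr0.
pose G i j : A := (i`!%:R^-1 * j`!%:R^-1 : F) *: (x ^+ i * y ^+ j).
have -> : texp n x * texp n y = \sum_(0 <= j < n) \sum_(0 <= i < n) G i j.
  rewrite exchange_big_nat /texp mulr_suml; apply: eq_bigr => i _.
  rewrite mulr_sumr; apply: eq_bigr => j _.
  by rewrite -scalerAl -scalerAr scalerA.
have -> : texp n (x + y) =
    \sum_(0 <= k < n) \sum_(0 <= i < n | (i < k.+1)%N) G (k - i)%N i.
  rewrite /texp big_nat [RHS]big_nat; apply: eq_bigr => k /andP[_ kn].
  rewrite -(big_nat_widen 0 k.+1 n xpredT (fun i => G (k - i)%N i)) //.
  rewrite exprDn scaler_sumr big_mkord.
  apply: eq_bigr => -[i /=]; rewrite ltnS => ik _.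
  rewrite -scaler_nat scalerA; congr (_ *: _).
  have bin0 : 'C(k, i)%:R != 0 :> F.
    by rewrite ((pcharf0P F).1 charF) -lt0n bin_gt0.
  rewrite -(bin_fact ik) !natrM; field.
  by rewrite bin0 !fact_neq0.
rewrite (exchange_big_dep_nat xpredT) //=; apply: eq_big_nat => j /andP[_ jn].
under eq_bigl do rewrite ltnS.
rewrite -(big_nat_widenl j 0 n xpredT (fun k => G (k - j)%N j)) //.
rewrite -{1}[j]add0n big_addn.
under eq_bigr do rewrite addnK.
rewrite [RHS](big_cat_nat (leq0n _) (leq_subr j n)) /=.
rewrite [X in _ + X]big_nat [X in _ + X]big1 ?addr0 // => i /andP[nji _].
rewrite /G; case: (leqP d i) => [di|id]; first by rewrite (exp0 x) ?mul0r ?scaler0.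
rewrite (exp0 y) ?mulr0 ?scaler0 //.
have nij : (n <= i + j)%N by rewrite addnC -leq_subLR.
rewrite leqNgt; apply/negP => jd.
have := leq_trans dn nij; rewrite leqNgt => /negP; apply.
by rewrite -addnS leq_add // ltnW.
Qed.

End TruncatedExponential.

(** * The unital extension as a commutative algebra, where the binomial theorem is available *)

Definition unital_ring (F : fieldType) (N : commNonunitalAlgType F) : Type :=
  unital_ext N.

Section UnitalRing.
Variables (F : fieldType) (N : commNonunitalAlgType F).
Implicit Types e f g : unital_ring N.

HB.instance Definition _ := GRing.Lmodule.copy (unital_ring N) (F^o * N)%type.

Definition unital_mul e f : unital_ring N := uext_mul e f.

Lemma unital_mulA : associative unital_mul.
Proof.
move=> [a x] [b y] [c z]; rewrite /unital_mul /uext_mul /= mulrA; congr pair.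
rewrite !(nmulDl, nmulDr, nmulZl, nmulZr, scalerDr, scalerA) nmulA.
rewrite [c * a]mulrC [c * b]mulrC -!addrA; do 2!congr (_ + _).
rewrite addrCA; congr (_ + _); rewrite [RHS]addrCA; congr (_ + _).
by rewrite addrCA.
Qed.

Lemma unital_mulC : commutative unital_mul.
Proof.
move=> [a x] [b y]; rewrite /unital_mul /uext_mul /= mulrC nmulC.
by rewrite [a *: y + _]addrC.
Qed.

Lemma unital_mul1 : left_id ((1, 0) : unital_ring N) unital_mul.
Proof.
move=> [a x]; rewrite /unital_mul /uext_mul /= mul1r scale1r scaler0 addr0.
by rewrite nmulC linear0 addr0.
Qed.

Lemma unital_mulDl : left_distributive unital_mul +%R.
Proof.
move=> [a x] [b y] [c z]; rewrite /unital_mul /uext_mul /= mulrDl.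
congr pair; rewrite scalerDl scalerDr nmulDl /=.
by rewrite [RHS]addrACA; congr (_ + _); rewrite addrACA.
Qed.

Lemma unital_1neq0 : (1, 0) != 0 :> unital_ring N.
Proof. by apply/eqP => -[/eqP]; rewrite oner_eq0. Qed.

HB.instance Definition _ := GRing.Zmodule_isComNzRing.Build (unital_ring N)
  unital_mulA unital_mulC unital_mul1 unital_mulDl unital_1neq0.

Lemma unital_scaleAl (a : F) e f : a *: (e * f) = (a *: e) * f.
Proof.
case: e f => [b x] [c y]; congr pair => /=; first by rewrite -mulrA.
by rewrite !scalerDr !scalerA nmulZl [a * c]mulrC.
Qed.

HB.instance Definition _ :=
  GRing.Lmodule_isLalgebra.Build F (unital_ring N) unital_scaleAl.
HB.instance Definition _ := GRing.Lalgebra_isComAlgebra.Build F (unital_ring N).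

Definition unital_in (x : N) : unital_ring N := uext_in x.

Lemma unital_inX x k : unital_in x ^+ k.+1 = unital_in (npow x k.+1).
Proof.
elim: k => [|k IH]; first by rewrite expr1.
rewrite exprS IH; congr pair => /=; first by rewrite mul0r.
by rewrite !scale0r !add0r.
Qed.

Lemma texp_unital_in x n : nilpotent N -> (\dim {:N} <= n)%N ->
  texp n.+1 (unital_in x) = (1, exp1 x).
Proof.
move=> nN dn; rewrite /texp big_nat_recl // fact0 invr1 scale1r expr0.
have -> : \sum_(0 <= i < n) ((i.+1)`!%:R : F)^-1 *: unital_in x ^+ i.+1 =
    unital_in (exp1 x).
  rewrite (exp1E _ nN dn) big_add1 /=.
  elim: n {dn} => [|n IH]; first by rewrite !big_geq.
  rewrite !big_nat_recr //= IH unital_inX.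
  by congr pair; rewrite /= scaler0 addr0.
by congr pair; rewrite /= ?addr0 ?add0r.
Qed.

Lemma exp1D (charF : [pchar F] =i pred0) (x y : N) : nilpotent N ->
  exp1 (x + y) = exp1 x + exp1 y + nmul (exp1 x) (exp1 y).
Proof.
move=> nN; pose d := \dim {:N}.
have pow0 z : unital_in z ^+ d.+1 = 0 by rewrite unital_inX npow_eq0.
have dn : (d <= d + d.+1)%N by rewrite leq_addr.
have inD : unital_in (x + y) = unital_in x + unital_in y.
  by congr pair; rewrite /= addr0.
(* Every element of [N] has vanishing power [d.+1], and the truncation order is twice that
   exponent. *)
have := texpD (n := (d + d.+1).+1) charF (pow0 x) (pow0 y) (leqnn _).
rewrite -inD !(texp_unital_in _ nN dn) => -[_ ->].
by rewrite !scale1r [exp1 y + _]addrC.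
Qed.

End UnitalRing.

(** * Nilpotent algebras *)

Section NilpotentAlgebra.
Variables (F : fieldType) (N : commNonunitalAlgType F).
Hypotheses (charF : [pchar F] =i pred0) (nN : nilpotent N).
Implicit Types (x y z : N).

Lemma nmul_powv k x y : y \in powv N k.+1 -> nmul x y \in powv N k.+2.
Proof. by move=> yk; rewrite powvS memv_nprod ?memvf. Qed.

(** Iterating the equation pushes [z] into every power of [N]. *)
Lemma nmul_fix_eq0 x z : z = nmul x z -> z = 0.
Proof.
move=> zx; have [n n0] := nN.
suff : z \in powv N n.+1 by rewrite n0 memv0 => /eqP.
by elim: n {n0} => [|n IH]; [exact: memvf | rewrite zx nmul_powv].
Qed.

Lemma exp1_factor x : exists y, exp1 x = x + nmul y x.
Proof.
(* The witness is the series of [exp1 x - x] with one factor [x] removed, whence the factorial of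
   [k.+1]. *)
exists (\sum_(1 <= k < (\dim {:N}).+1) (k.+1`!%:R : F)^-1 *: npow x k).
rewrite (exp1E x nN (leqnSn _)) big_ltn // big_add1 invr1 scale1r.
congr (_ + _).
rewrite nmulC linear_sum; apply: eq_big_nat => k /andP[k0 _].
by rewrite linearZ /=; case: k k0.
Qed.

Lemma exp10 : exp1 (0 : N) = 0.
Proof. by have [y ->] := exp1_factor 0; rewrite linear0 addr0. Qed.

Lemma exp1_eq0 x : exp1 x = 0 -> x = 0.
Proof.
have [y ->] := exp1_factor x => /eqP; rewrite addrC addr_eq0 => /eqP e.
by apply: (@nmul_fix_eq0 (- y)); rewrite nmulC linearN /= nmulC e opprK.
Qed.

Lemma exp1_inj : injective (@exp1 F N).
Proof.
move=> x y e; apply/eqP; rewrite eq_sym -subr_eq0; apply/eqP/exp1_eq0.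
(* With [z = exp1 (y - x)], the addition formula and [exp1 x = exp1 y] give [z = - exp1 x * z]. *)
apply: (@nmul_fix_eq0 (- exp1 x)); rewrite nmulC linearN /= nmulC.
apply/eqP; rewrite -addr_eq0; apply/eqP; apply: (addrI (exp1 x)).
by rewrite addr0 addrA -exp1D // addrC subrK.
Qed.

(** Successive approximation: adding the error [d = y - exp1 x] to [x] leaves a new error in the
    next power of [N]. *)
Lemma exp1_surj y : exists x, exp1 x = y.
Proof.
have H k : exists x, y - exp1 x \in powv N k.+1.
  elim: k => [|k [x yx]]; first by exists 0; exact: memvf.
  have [d ed] : exists d, y = d + exp1 x by exists (y - exp1 x); rewrite subrK.
  move: yx; rewrite ed addrK => dk; exists (x + d).
  have [z e] := exp1_factor d.
  have -> : d + exp1 x - exp1 (x + d) =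
      - (nmul z d + nmul (exp1 x) (d + nmul z d)).
    rewrite exp1D // e [exp1 x + (d + _)]addrCA addrA -[X in _ - X]addrA.
    by rewrite opprD addrA subrr add0r.
  rewrite memvN memvD ?nmul_powv // memvD // (subvP (powvSS _)) //.
  exact: nmul_powv.
have [n n0] := nN; have [x] := H n.
by rewrite n0 memv0 subr_eq0 => /eqP e; exists x.
Qed.

Lemma exp1_annihilator x a : a \in annihilator N -> exp1 (x + a) = exp1 x + a.
Proof.
move=> /annihilatorP a0; have [y ea] := exp1_factor a.
have {}ea : exp1 a = a by rewrite ea nmulC a0 addr0.
by rewrite exp1D // ea [nmul _ a]nmulC a0 addr0.
Qed.

Lemma npowZ (t : F) x k : (0 < k)%N -> npow (t *: x) k = t ^+ k *: npow x k.
Proof.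
case: k => // k _; elim: k => [|k IH]; first by rewrite expr1.
by rewrite /npow /= -!/(npow _ k.+1) IH nmulZl nmulZr scalerA -exprS.
Qed.

Lemma exp1Z (t : F) x n : (\dim {:N} <= n)%N ->
  exp1 (t *: x) = \sum_(1 <= k < n.+1) t ^+ k *: ((k`!%:R : F)^-1 *: npow x k).
Proof.
move=> dn; rewrite (exp1E _ nN dn); apply: eq_big_nat => k /andP[k0 _].
by rewrite npowZ // !scalerA mulrC.
Qed.

(** Expanding one factor [x] in a basis lowers the exponent and changes the form [h], so the
    induction runs over all [h] at once. *)
Lemma polyfun_npow k (h : {scalar N}) : polyfun (fun x => h (npow x k)).
Proof.
case: k => [|k]; first exact: PolyfunScalar.
elim: k h => [|k IH] h; first exact: PolyfunScalar.
pose b := vbasis {:N}.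
rewrite (_ : (fun _ => _) = fun x : N =>
  \sum_i coord b i x * (h \o nmul b`_i) (npow x k.+1)).
  apply: polyfun_sum => i; apply: PolyfunMul; first exact: PolyfunScalar.
  exact: IH.
apply/funext => x; rewrite /npow /= -/(npow x k.+1) nmulC.
rewrite {2}(coord_vbasis (memvf x)) !linear_sum; apply: eq_bigr => i _ /=.
by rewrite !linearZ /= nmulC.
Qed.

Lemma polyfun_exp1 (h : {scalar N}) : polyfun (fun x => h (exp1 x)).
Proof.
rewrite (_ : (fun _ => _) = fun x =>
  \sum_(1 <= k < (\dim {:N}).+1) ((k`!%:R : F)^-1 * h (npow x k))).
  apply: polyfun_sum => k; apply: PolyfunMul; first exact: PolyfunConst.
  exact: polyfun_npow.
apply/funext => x; rewrite linear_sum; apply: eq_bigr => k _.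
by rewrite linearZ.
Qed.

(** The bound [n] stays free so that algebras of different dimensions can be compared over one range
    of degrees. *)
Lemma exp1_coef (h : {scalar N}) n : (\dim {:N} <= n)%N -> forall t x,
  h (exp1 (t *: x)) = \sum_(1 <= k < n.+1) t ^+ k * ((k`!%:R)^-1 * h (npow x k)).
Proof.
move=> dn t x; rewrite (exp1Z _ _ dn) linear_sum; apply: eq_bigr => k _.
by rewrite !linearZ.
Qed.

End NilpotentAlgebra.

(** * Linear forms that are nonzero on the annihilator *)

Section Dual.
Variables (F : fieldType) (V : vectType F).

Definition dual_vect (h : {scalar V}) : 'Hom(V, F^o) :=
  linfun (h : {linear V -> F^o}).

Lemma dual_vectE h x : dual_vect h x = h x.
Proof. by rewrite lfunE. Qed.

Definition dual_eval (x : V) (h : 'Hom(V, F^o)) : F^o := h x.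

Lemma dual_eval_linear x : linear (dual_eval x).
Proof. by move=> a g h; rewrite /dual_eval add_lfunE scale_lfunE. Qed.
HB.instance Definition _ x :=
  GRing.isLinear.Build F 'Hom(V, F^o) F^o _ (dual_eval x) (dual_eval_linear x).

End Dual.

Section DualMul.
Variables (F : fieldType) (N : commNonunitalAlgType F) (phi : {scalar N}).

Definition dual_mul (y : N) : 'Hom(N, F^o) := dual_vect (phi \o nmul y).

Lemma dual_mul_linear : linear dual_mul.
Proof.
move=> a x y; apply/lfunP => z.
by rewrite add_lfunE scale_lfunE !dual_vectE /= nmulDl nmulZl linearD linearZ.
Qed.
HB.instance Definition _ :=
  GRing.isLinear.Build F N 'Hom(N, F^o) _ dual_mul dual_mul_linear.

End DualMul.

Section AdmissibleFunctional.
Variables (F : fieldType) (N : commNonunitalAlgType F).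
Hypotheses (charF : [pchar F] =i pred0) (nN : nilpotent N).
Variables (w : N) (phi : {scalar N}).
Hypotheses (annN : annihilator N = <[w]>%VS) (phiw : phi w = 1).

Lemma annihilator_phi a : a \in annihilator N -> a = phi a *: w.
Proof.
by rewrite annN => /vlineP[k ->]; rewrite linearZ /= phiw mulr1.
Qed.

Lemma nmul_annihilator_gen x : nmul w x = 0.
Proof. by move: x; apply/annihilatorP; rewrite annN memv_line. Qed.

Lemma exp1_shift x t : phi (exp1 (x + t *: w)) = phi (exp1 x) + t.
Proof.
rewrite exp1_annihilator //; last by rewrite annN memvZ ?memv_line.
by rewrite linearD linearZ /= phiw mulr1.
Qed.

(* A nonzero ideal meets the annihilator, hence is not contained in [ker phi]. *)
Lemma phi_ideal_eq0 y : phi y = 0 -> (forall x, phi (nmul y x) = 0) -> y = 0.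
Proof.
have [n n0] := nN.
have H k : (k <= n)%N -> forall y, y \in powv N (n - k).+1 -> phi y = 0 ->
    (forall x, phi (nmul y x) = 0) -> y = 0.
  elim: k => [|k IH] kn z; first by rewrite subn0 n0 memv0 => /eqP.
  (* Each product [nmul z x] lies one power deeper and inherits both vanishing conditions, so it is
     0 by induction. *)
  move=> zk z0 zN0; have Az : z \in annihilator N.
    apply/annihilatorP => x; apply: (IH (ltnW kn)) => // [|s].
      by rewrite -(subnSK kn) nmulC nmul_powv.
    by rewrite -nmulA.
  by rewrite (annihilator_phi Az) z0 scale0r.
by apply: (H n) => //; rewrite subnn memvf.
Qed.

Lemma phi_nondegenerate y : (forall x, phi (nmul y x) = 0) -> y \in annihilator N.
Proof.
move=> y0; apply/annihilatorP => x; apply: phi_ideal_eq0 => // z.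
by rewrite -nmulA.
Qed.

(** A dimension count: [T] maps [y] to the form [phi (nmul y _)] and has the annihilator, a line, as
    kernel. Its image lies in the hyperplane of forms vanishing at [w], hence fills it. *)
Lemma scalar_represented (psi : {scalar N}) : psi w = 0 ->
  exists y, forall x, psi x = phi (nmul y x).
Proof.
move=> psiw.
pose T := linfun (dual_mul phi); pose E := linfun (dual_eval w).
have TE y x : T y x = phi (nmul y x) by rewrite lfunE dual_vectE.
have EE h : E h = h w by rewrite lfunE.
have kerT : lker T = annihilator N.
  apply/vspaceP => y; rewrite memv_ker; apply/eqP/annihilatorP => [Ty x|y0].
    move: x; apply/annihilatorP/phi_nondegenerate => x.
    by rewrite -TE Ty lfunE.
  by apply/lfunP => x; rewrite TE y0 linear0 lfunE.
have dimT : (\dim (limg T) + 1 = \dim {:N})%N.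
  rewrite -(limg_ker_dim T fullv) capfv kerT annN dim_vline addnC.
  suff -> : w != 0 by [].
  by apply: contra_eq_neq phiw => ->; rewrite linear0 eq_sym oner_neq0.
have sTE : (limg T <= lker E)%VS.
  apply/subvP => _ /memv_imgP[y _ ->].
  by rewrite memv_ker EE TE nmulC nmul_annihilator_gen linear0.
have dimE : (\dim (lker E) + 1 <= \dim {:N})%N.
  have <- : \dim {:'Hom(N, F^o)} = \dim {:N}.
    by rewrite !dimvf; exact: muln1.
  rewrite -(limg_ker_dim E fullv) capfv leq_add2l lt0n dimv_eq0.
  apply/eqP => E0; have : E (dual_vect phi) \in limg E by rewrite memv_img ?memvf.
  by rewrite E0 memv0 EE dual_vectE phiw oner_eq0.
have eTE : limg T = lker E.
  by apply/eqP; rewrite eqEdim sTE -(leq_add2r 1) dimT.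
have : dual_vect psi \in limg T.
  by rewrite eTE memv_ker EE dual_vectE psiw.
by case/memv_imgP => y _ ey; exists y => x; rewrite -TE -ey dual_vectE.
Qed.

Lemma scalar_exp_shift (psi : {scalar N}) : psi w = 1 ->
  exists2 c, phi (exp1 c) = 0 & forall x, psi x = phi (x + nmul (exp1 c) x).
Proof.
move=> psiw; have [|y ey] := @scalar_represented (psi \- phi).
  by rewrite /= psiw phiw subrr.
have [b eb] := exp1_surj charF nN y.
(* Moving [b] along [w] reaches a zero of [phi] composed with [exp1], and products with [exp1 b] do
   not change because [w] annihilates [N]. *)
exists (b + (- phi (exp1 b)) *: w); first by rewrite exp1_shift subrr.
move=> x; rewrite exp1_annihilator //; last by rewrite annN memvZ ?memv_line.
rewrite nmulDl nmulZl nmul_annihilator_gen scaler0 addr0 eb.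
by rewrite linearD -ey /= addrC subrK.
Qed.

Lemma scalar_exp_shift_inj c d : phi (exp1 c) = 0 -> phi (exp1 d) = 0 ->
  (forall x, phi (x + nmul (exp1 c) x) = phi (x + nmul (exp1 d) x)) -> c = d.
Proof.
move=> c0 d0 cd; apply: (exp1_inj charF nN); apply/subr0_eq.
apply: phi_ideal_eq0 => [|x]; first by rewrite linearB /= c0 d0 subrr.
have := cd x; rewrite !linearD /= => /addrI e.
by rewrite nmulDl linearD e -linearD -nmulDl subrr nmulC !linear0.
Qed.

(** Composing [phi] with multiplication by exp [c] translates the function [phi (exp1 x)] by [c]:
    the remaining term [phi (exp1 c)] vanishes. *)
Lemma exp1_translate c x : phi (exp1 c) = 0 ->
  phi (exp1 (x + c)) = phi (exp1 x + nmul (exp1 c) (exp1 x)).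
Proof. by move=> c0; rewrite addrC exp1D // !linearD /= c0 add0r. Qed.

Lemma scalar_eq_zeros (psi : {scalar N}) : psi w = 1 ->
  (forall x, phi (exp1 x) = 0 -> psi (exp1 x) = 0) -> phi =1 psi.
Proof.
move=> psiw pp x.
(* Subtracting [phi (exp1 y) *: w] from [y] gives a common zero, and both functions have slope one
   along [w]. *)
have e y : phi (exp1 y) = psi (exp1 y).
  have /pp : phi (exp1 (y + (- phi (exp1 y)) *: w)) = 0.
    by rewrite exp1_shift subrr.
  rewrite exp1_annihilator //; last by rewrite annN memvZ ?memv_line.
  rewrite linearD linearZ /= psiw mulr1 => /eqP.
  by rewrite addr_eq0 opprK => /eqP.
have dn : (\dim {:N} <= (\dim {:N}).+1)%N by [].
have := coef_fun_inj charF (n := (\dim {:N}).+1) _ (k := 1).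
move=> /(_ (fun k => (k`!%:R)^-1 * phi (npow x k))
  (fun k => (k`!%:R)^-1 * psi (npow x k))).
rewrite invr1 !mul1r; apply => // t.
by rewrite -!(exp1_coef _ _ dn).
Qed.

End AdmissibleFunctional.

(** * Linear maps between the zero sets *)

Section LinearImage.
Variables (F : fieldType) (N Nt : commNonunitalAlgType F).
Hypotheses (charF : [pchar F] =i pred0) (nN : nilpotent N) (nNt : nilpotent Nt).
Variables (w : N) (phi : {scalar N}) (wt : Nt) (phit : {scalar Nt}).
Hypotheses (annN : annihilator N = <[w]>%VS) (phiw : phi w = 1).
Hypotheses (annNt : annihilator Nt = <[wt]>%VS) (phitw : phit wt = 1).
Hypothesis dimNt : (1 < \dim {:Nt})%N.
Variable L : 'Hom(N, Nt).
Hypothesis LS : forall y,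
  phit (exp1 y) = 0 <-> exists2 x, phi (exp1 x) = 0 & L x = y.

(** Otherwise polarization makes the whole algebra its own annihilator, of dimension 1, against
    [dimNt]. *)
Lemma quadratic_nonzero : exists y, phit (nmul y y) != 0.
Proof.
apply/not_existsP => q0; suff annT : annihilator Nt = fullv.
  have := dim_vline wt; rewrite -annNt annT => e.
  by move: dimNt; rewrite e; case: (_ != _).
apply/vspaceP => x; rewrite memvf.
apply: (phi_nondegenerate nNt annNt phitw).
apply: (polarize2 charF (B := fun x y => phit (nmul x y))) => [y z t|y z|y].
- by rewrite nmulDl linearD.
- by rewrite nmulC.
- by apply/eqP/negPn/negP; exact: q0.
Qed.

(* [Sset] is the graph of a function with nonzero quadratic part, so no
   hyperplane contains it. *)
Lemma scalar_vanish_limg (h : {scalar Nt}) :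
  (forall x, h (L x) = 0) -> forall y, h y = 0.
Proof.
move=> hL; have e y : h y = phit (exp1 y) * h wt.
  have /LS[x _ ex] : phit (exp1 (y + (- phit (exp1 y)) *: wt)) = 0.
    by rewrite (exp1_shift charF nNt annNt phitw) subrr.
  have := hL x; rewrite ex linearD linearZ /= mulNr => /eqP.
  by rewrite subr_eq0 => /eqP.
suff hwt : h wt = 0 by move=> y; rewrite e hwt mulr0.
have [y qy] := quadratic_nonzero.
have dn : (\dim {:Nt} <= (\dim {:Nt}).+2)%N by rewrite ltnW.
(* In [e (t *: y)] the left side is linear in [t], so the coefficient of degree 2 on the right is
   0. *)
suff /eqP : 0 = (2`!%:R)^-1 * phit (npow y 2) * h wt.
  rewrite eq_sym !mulf_eq0 invr_eq0 (negbTE qy) orbF.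
  by rewrite (negbTE (fact_neq0 charF 2)) => /eqP.
apply: (coef_fun_inj charF (n := (\dim {:Nt}).+2)
  (a := fun k => if k == 1 then h y else 0)
  (b := fun k => (k`!%:R)^-1 * phit (npow y k) * h wt) _ (k := 2)) => // t.
rewrite big_ltn // expr1 big_nat big1 ?addr0; last first.
  by case=> [|[|k]] // _; rewrite mulr0.
have := e (t *: y); rewrite linearZ /= (exp1_coef nNt _ dn) mulr_suml => ->.
by apply: eq_bigr => k _; rewrite -mulrA.
Qed.

Lemma linear_image_full : limg L = fullv.
Proof.
apply/vspaceP => y; rewrite memvf.
(* The coordinate forms of the projection along the image vanish on the image, hence everywhere. *)
pose P := (\1 - projv (limg L))%VF.
have PE x : P x = x - projv (limg L) x by rewrite add_lfunE opp_lfunE id_lfunE.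
suff : P y = 0 by rewrite PE => /subr0_eq ->; exact: memv_proj.
rewrite (coord_vbasis (memvf (P y))) big1 // => i _.
have := @scalar_vanish_limg (coord (vbasis {:Nt}) i \o P).
move=> /= -> //; first by rewrite scale0r.
by move=> x; rewrite PE projv_id ?memv_img ?memvf // subrr linear0.
Qed.

Lemma linear_image_surj y : exists x, L x = y.
Proof.
have : y \in limg L by rewrite linear_image_full memvf.
by case/memv_imgP => x _ ->; exists x.
Qed.

Lemma linear_image_zeros x : phi (exp1 x) = 0 -> phit (exp1 (L x)) = 0.
Proof. by move=> x0; apply/LS; exists x. Qed.

Lemma linear_image_lker0 : lker L = 0%VS.
Proof.
apply/eqP; rewrite -subv0; apply/subvP => v; rewrite memv_ker memv0 => /eqP Lv.
pose f x := phi (exp1 x); pose g y := phit (exp1 y).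
have pf : polyfun f by exact: polyfun_exp1.
have pg : polyfun g by exact: polyfun_exp1.
have pd : polyfun (fun x => f (x + v) + (-1) * f x).
  apply: PolyfunAdd; last by apply: PolyfunMul => //; exact: PolyfunConst.
  have := polyfun_affine \1%VF v pf; congr (polyfun _).
  by apply/funext => x; rewrite id_lfunE.
have pgL : polyfun (fun x => g (L x)).
  have := polyfun_affine L 0 pg; congr (polyfun _).
  by apply/funext => x; rewrite addr0.
(* If [v] is not a period at [x], then [p], the restriction of [f] to the line through [x] along
   [v], is not constant. *)
have fg0 x : (f (x + v) + (-1) * f x) * g (L x) = 0.
  apply/eqP; rewrite mulf_eq0 mulN1r subr_eq0.
  case: eqVneq => //= fv.
  have [p ep] := polyfun_line x v pf; have [q eq] := polyfun_line (L x) (- L w) pg.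
  have sp : (1 < size p)%N.
    rewrite ltnNge; apply: contra fv => /size1_polyC pc.
    move: (ep 0) (ep 1); rewrite pc !hornerC scale0r addr0 scale1r => -> ->.
    by [].
  (* The zeros [x + t *: v - p.[t] *: w] of [f] are mapped by [L] to [L x - p.[t] *: L w], since
     [L v = 0]; these are zeros of [g]. As [p] is not constant, [q = 0]. *)
  have : q \Po p == 0.
    apply/eqP/(poly_fun0 charF) => t; rewrite horner_comp -eq -ep.
    have : f (x + t *: v + (- f (x + t *: v)) *: w) = 0.
      by rewrite /f (exp1_shift charF nN annN phiw) subrr.
    move/linear_image_zeros; rewrite !linearD !linearZ /= Lv scaler0 addr0 => e.
    by rewrite -[RHS]e scalerN scaleNr.
  rewrite comp_poly_eq0 // => /eqP q0.
  by have := eq 0; rewrite q0 horner0 scale0r addr0 => ->.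
have [fv|gL] := polyfun_mul_eq0 charF pd pgL fg0; last first.
  have [x ex] := linear_image_surj wt; have := gL x; rewrite /g ex.
  have := exp1_shift charF nNt annNt phitw 0 1.
  rewrite scale1r add0r => -> /eqP.
  by rewrite exp10 // linear0 add0r oner_eq0.
(* Rewriting the period condition by the addition formula places [exp1 v] in the radical of the
   form, because [exp1] is onto. *)
have {}fv x : phi (exp1 v) + phi (nmul (exp1 x) (exp1 v)) = 0.
  have := fv x; rewrite /f exp1D // !linearD /= mulN1r => <-.
  ring.
have v0 : phi (exp1 v) = 0.
  by have := fv 0; rewrite exp10 // nmulC !linear0 addr0.
apply/eqP/(exp1_eq0 nN)/(phi_ideal_eq0 nN annN phiw v0) => x.
have [y <-] := exp1_surj charF nN x.
by have := fv y; rewrite v0 add0r nmulC.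
Qed.

Lemma linear_image_zerosP x : phi (exp1 x) = 0 <-> phit (exp1 (L x)) = 0.
Proof.
split; first exact: linear_image_zeros.
move=> /LS[y y0 e]; suff <- : y = x by [].
by have /lker0P := introT eqP linear_image_lker0; apply.
Qed.

Lemma linear_imageVK y : L (L^-1%VF y) = y.
Proof. by rewrite limg_lfunVK // linear_image_full memvf. Qed.

Lemma npow_proportional : exists2 q, q != 0 &
  forall k x, (0 < k)%N -> phit (npow (L x) k) = q * phi (npow x k).
Proof.
have [||q q0 e] := @polyfun_eq_zeros _ charF N (fun x => phi (exp1 x))
    (fun x => phit (exp1 (L x + 0))) w (L^-1%VF wt) (polyfun_exp1 _)
    (polyfun_affine L 0 (polyfun_exp1 _)) (exp1_shift charF nN annN phiw).
- move=> x t; rewrite !addr0 linearD linearZ /= linear_imageVK.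
  by rewrite (exp1_shift charF nNt annNt phitw).
- by move=> x; rewrite addr0; exact: linear_image_zerosP.
(* This [n] bounds both dimensions and keeps degree [k] in range. *)
exists q => // k x k0; pose n := (\dim {:N} + \dim {:Nt} + k)%N.
have dn : (\dim {:N} <= n)%N by rewrite /n -addnA leq_addr.
have dnt : (\dim {:Nt} <= n)%N by rewrite /n addnAC leq_addl.
apply: (mulfI (invr_neq0 (fact_neq0 charF k))); rewrite mulrCA.
apply: (coef_fun_inj charF (n := n)
  (a := fun k => k`!%:R^-1 * phit (npow (L x) k))
  (b := fun k => q * (k`!%:R^-1 * phi (npow x k)))) => [t|]; last first.
  by rewrite k0 leq_addl.
have := e (t *: x); rewrite addr0 linearZ (exp1_coef nNt _ dnt) => ->.
rewrite (exp1_coef nN _ dn) mulr_sumr.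
by apply: eq_bigr => i _; rewrite mulrCA.
Qed.

Lemma linear_image_alg_iso : alg_iso L.
Proof.
have K0 := introT eqP linear_image_lker0.
split; first by exists L^-1%VF => [x|y]; [exact: lker0_lfunK | exact: linear_imageVK].
have [q q0 e] := npow_proportional.
have e2 x y : phit (nmul (L x) (L y)) = q * phi (nmul x y).
  apply/subr0_eq; move: x y.
  apply: (polarize2 charF
    (B := fun x y => phit (nmul (L x) (L y)) - q * phi (nmul x y))).
  - by move=> x y z; rewrite linearD !nmulDl !linearD /=; ring.
  - by move=> x y; rewrite nmulC [nmul x y]nmulC.
  - by move=> x; rewrite (e 2%N) // subrr.
have e3 x y z : phit (nmul (L x) (nmul (L y) (L z))) = q * phi (nmul x (nmul y z)).
  apply/subr0_eq; move: x y z.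
  apply: (polarize3 charF (T := fun x y z => phit (nmul (L x) (nmul (L y) (L z)))
    - q * phi (nmul x (nmul y z)))).
  - by move=> x y z t; rewrite linearD !nmulDl !linearD /=; ring.
  - by move=> x y z; rewrite !nmulA [nmul x y]nmulC [nmul (L x) (L y)]nmulC.
  - by move=> x y z; rewrite [nmul y z]nmulC [nmul (L y) (L z)]nmulC.
  - by move=> x; rewrite (e 3%N) // subrr.
(* The form [phit] kills [L (nmul x y) - nmul (L x) (L y)] by degrees 1 and 2, and its product with
   any [L z] by degrees 2 and 3. *)
move=> x y; apply/subr0_eq/(phi_ideal_eq0 nNt annNt phitw).
  by rewrite linearB /= e2 (e 1%N) // subrr.
move=> z; have [{}z <-] := linear_image_surj z.
rewrite nmulDl [nmul (- _) _]nmulC linearN linearB /= e2 nmulC e3.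
by rewrite [nmul z _]nmulC subrr.
Qed.

End LinearImage.

(** * Admissible projections and isomorphisms *)

Section AdmissibleProjections.
Variables (F : fieldType) (N : commNonunitalAlgType F).
Implicit Types (pi : 'End(N)) (w : N).

Lemma annihilator_line : \dim (annihilator N) = 1%N ->
  exists2 w, w != 0 & annihilator N = <[w]>%VS.
Proof.
move=> d1; exists (vpick (annihilator N)); first by rewrite vpick0 -dimv_eq0 d1.
apply/esym/eqP; rewrite eqEdim -memvE memv_pick d1 dim_vline vpick0.
by rewrite -dimv_eq0 d1.
Qed.

Lemma scalar_of_projection pi w : w != 0 -> annihilator N = <[w]>%VS ->
  admissible_projections N pi ->
  exists2 phi : {scalar N}, phi w = 1 & forall x, pi x = phi x *: w.
Proof.
move=> w0 annN [pi2 limpi].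
have piE x : pi x = coord [tuple w] ord0 (pi x) *: w.
  have : pi x \in <<[tuple w]>>%VS.
    by rewrite span_seq1 -annN -limpi memv_img ?memvf.
  by move=> /coord_span {1}->; rewrite big_ord1.
exists (coord [tuple w] ord0 \o pi) => //=.
have /memv_imgP[u _ wu] : w \in limg pi by rewrite limpi annN memv_line.
have piw : pi w = w by rewrite {1}wu -comp_lfunE pi2 -wu.
apply/eqP; rewrite -subr_eq0 -[_ == 0]orbF -(negbTE w0) -scaler_eq0.
by rewrite scalerBl -piE piw scale1r subrr.
Qed.

Lemma projection_of_scalar pi w (phi : {scalar N}) : annihilator N = <[w]>%VS ->
  phi w = 1 -> (forall x, pi x = phi x *: w) -> admissible_projections N pi.
Proof.
move=> annN phiw piE; split.
  by apply/lfunP => x; rewrite comp_lfunE !piE linearZ /= phiw mulr1.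
rewrite annN; apply/vspaceP => x; apply/memv_imgP/vlineP => [[u _ ->]|[k ->]].
  by exists (phi u); rewrite piE.
by exists (k *: w); rewrite ?memvf // piE linearZ /= phiw mulr1.
Qed.

Lemma Sset_scalar pi w (phi : {scalar N}) : w != 0 ->
  (forall x, pi x = phi x *: w) -> forall x, Sset pi x <-> phi (exp1 x) = 0.
Proof.
move=> w0 piE x; rewrite /Sset /= piE; split=> [/eqP|->]; last exact: scale0r.
by rewrite scaler_eq0 (negbTE w0) orbF => /eqP.
Qed.

Lemma mulop_uexp (c x : N) : mulop (uexp c) x = x + nmul (exp1 c) x.
Proof.
rewrite lfunE -[LHS]/(1 *: x + 0 *: exp1 c + nmul (exp1 c) x).
by rewrite scale1r scale0r addr0.
Qed.

End AdmissibleProjections.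

Section Isomorphism.
Variables (F : fieldType) (N Nt : commNonunitalAlgType F) (L : 'Hom(N, Nt)).
Hypotheses (nN : nilpotent N) (nNt : nilpotent Nt) (isoL : alg_iso L).

Lemma alg_iso_inj : injective L.
Proof. by case: isoL => /bij_inj. Qed.

Lemma alg_isoK : cancel L L^-1%VF.
Proof. exact/lker0_lfunK/lker0P/alg_iso_inj. Qed.

Lemma alg_isoVK : cancel L^-1%VF L.
Proof. by case: isoL => -[g _ gK] _ y; rewrite -(gK y) alg_isoK. Qed.

Lemma alg_iso_npow x k : L (npow x k) = npow (L x) k.
Proof.
case: k => [|k] //; elim: k => [|k IH] //.
by rewrite -[npow x _]/(nmul x (npow x k.+1)) isoL.2 IH.
Qed.

Lemma alg_iso_exp1 x : L (exp1 x) = exp1 (L x).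
Proof.
rewrite (exp1E _ nN (leq_addr (\dim {:Nt}) _)) (exp1E _ nNt (leq_addl (\dim {:N}) _)).
by rewrite linear_sum; apply: eq_bigr => k _; rewrite linearZ /= alg_iso_npow.
Qed.

Lemma alg_iso_annihilator w : annihilator N = <[w]>%VS ->
  annihilator Nt = <[L w]>%VS.
Proof.
move=> annN; apply/vspaceP => y; apply/annihilatorP/vlineP => [y0|[k ->] z].
  have /vlineP[k e] : L^-1%VF y \in <[w]>%VS.
    rewrite -annN; apply/annihilatorP => x; apply: alg_iso_inj.
    by rewrite isoL.2 alg_isoVK y0 linear0.
  by exists k; rewrite -[y]alg_isoVK e linearZ.
rewrite nmulZl -[z]alg_isoVK -isoL.2.
have /annihilatorP-> : w \in annihilator N by rewrite annN memv_line.
by rewrite linear0 scaler0.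
Qed.

End Isomorphism.

(** * Translated zero sets and conjugated projections *)

Section Matching.
Variables (F : fieldType) (N Nt : commNonunitalAlgType F).
Hypotheses (charF : [pchar F] =i pred0) (nN : nilpotent N) (nNt : nilpotent Nt).
Variables (w : N) (pi : 'End(N)) (phi : {scalar N}).
Hypotheses (w0 : w != 0) (annN : annihilator N = <[w]>%VS).
Hypotheses (phiw : phi w = 1) (piE : forall x, pi x = phi x *: w).

Lemma translated_scalar c x : phi (exp1 c) = 0 ->
  phi (mulop (uexp c) (exp1 x)) = phi (exp1 (x + c)).
Proof. by move=> c0; rewrite mulop_uexp exp1_translate. Qed.

Lemma translated_scalar_gen c : (phi \o mulop (uexp c)) w = 1.
Proof.
by rewrite /= mulop_uexp nmulC (nmul_annihilator_gen annN) addr0.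
Qed.

Section WithTarget.
Variables (L : 'Hom(N, Nt)) (rho : 'End(Nt)).
Hypothesis (hrho : admissible_projections Nt rho).

Lemma matching_alg_iso : \dim (annihilator Nt) = 1%N -> (1 < \dim {:Nt})%N ->
  (exists c, Sset rho = L @` translate (Sset pi) c) -> alg_iso L.
Proof.
move=> /annihilator_line[wt wt0 annNt] dNt [c eS].
have [psi psiw rhoE] := scalar_of_projection wt0 annNt hrho.
have Spi := Sset_scalar w0 piE; have Srho := Sset_scalar wt0 rhoE.
(* Injectivity of [L] is not yet known, so [c] is replaced by some [s] in [Sset pi] with
   [L s = L c]. Composing [phi] with multiplication by exp [s] then reduces to translation by 0. *)
have : Sset rho 0 by rewrite /Sset /= exp10 // linear0.
rewrite eS => -[_ [s /Spi s0 <-]]; rewrite linearB /= => /subr0_eq Ls.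
apply: (@linear_image_alg_iso _ _ _ charF nN nNt w
  (phi \o mulop (uexp s)) wt psi) => //.
  exact: translated_scalar_gen.
move=> y; rewrite -Srho eS; split.
  move=> [_ [u /Spi u0 <-] <-]; exists (u - s); last by rewrite !linearB /= Ls.
  by rewrite /= translated_scalar // subrK.
move=> [x]; rewrite /= translated_scalar // => /Spi xs <-.
by exists (x + s - c); [exists (x + s) | rewrite linearB linearD /= Ls addrK].
Qed.

Hypothesis isoL : alg_iso L.

Lemma alg_iso_gen_neq0 : L w != 0.
Proof.
by apply: contra w0 => /eqP e; apply/eqP/(alg_iso_inj isoL); rewrite linear0.
Qed.

Section WithScalar.
Variable psi : {scalar Nt}.
Hypotheses (psiw : psi (L w) = 1) (rhoE : forall y, rho y = psi y *: L w).

Lemma matching_scalarP c :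
  Sset rho = L @` translate (Sset pi) c <->
  phi (exp1 c) = 0 /\ forall x, psi (L x) = phi (x + nmul (exp1 c) x).
Proof.
have Spi := Sset_scalar w0 piE; have Srho := Sset_scalar alg_iso_gen_neq0 rhoE.
split=> [eS|[c0 e]]; last first.
  have SL x : Sset rho (L x) <-> Sset pi (x + c).
    by rewrite Srho Spi -alg_iso_exp1 // e exp1_translate.
  apply/seteqP; split=> y.
    rewrite -[y](alg_isoVK isoL) => /SL h; exists (L^-1%VF y) => //.
    by exists (L^-1%VF y + c); rewrite ?addrK.
  by move=> [_ [s sS <-] <-]; apply/SL; rewrite subrK.
(* The point 0 of [Sset rho] comes from [c] itself, which therefore lies in [Sset pi]. *)
have : Sset rho 0 by rewrite /Sset /= exp10 // linear0.
rewrite eS => -[_ [s /Spi s0 <-]]; rewrite -(linear0 L) => /(alg_iso_inj isoL).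
move=> /subr0_eq sc; have c0 : phi (exp1 c) = 0 by rewrite -sc.
split=> // x; rewrite -mulop_uexp.
(* Both forms take the value 1 at [w], so one inclusion of zero sets suffices. *)
apply: (@scalar_eq_zeros _ _ charF nN w (psi \o L) annN psiw
  (phi \o mulop (uexp c))); first exact: translated_scalar_gen.
move=> {}x; rewrite /= alg_iso_exp1 // => /Srho; rewrite eS.
move=> [_ [u /Spi u0 <-] /(alg_iso_inj isoL) <-].
by rewrite /= (translated_scalar _ c0) subrK.
Qed.

Lemma conjugate_scalarP c :
  rho = (L \o (pi \o mulop (uexp c)) \o L^-1)%VF <->
  forall x, psi (L x) = phi (x + nmul (exp1 c) x).
Proof.
split=> [e x|e].
  have := rhoE (L x); rewrite e !comp_lfunE /= (alg_isoK isoL) mulop_uexp piE.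
  rewrite linearZ /= => /eqP; rewrite -subr_eq0 -scalerBl scaler_eq0.
  by rewrite (negbTE alg_iso_gen_neq0) orbF subr_eq0 => /eqP.
apply/lfunP => y; rewrite rhoE !comp_lfunE /= mulop_uexp piE linearZ /= -e.
by rewrite (alg_isoVK isoL).
Qed.

End WithScalar.

Lemma matchingP c : Sset rho = L @` translate (Sset pi) c <->
  Sset pi c /\ rho = (L \o (pi \o mulop (uexp c)) \o L^-1)%VF.
Proof.
have annNt := alg_iso_annihilator isoL annN.
have [psi psiw rhoE] := scalar_of_projection alg_iso_gen_neq0 annNt hrho.
rewrite (matching_scalarP psiw rhoE) (conjugate_scalarP rhoE).
by rewrite (Sset_scalar w0 piE).
Qed.

Lemma matching_inj c d : Sset rho = L @` translate (Sset pi) c ->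
  Sset rho = L @` translate (Sset pi) d -> c = d.
Proof.
have annNt := alg_iso_annihilator isoL annN.
have [psi psiw rhoE] := scalar_of_projection alg_iso_gen_neq0 annNt hrho.
move=> /(matching_scalarP psiw rhoE)[c0 ec] /(matching_scalarP psiw rhoE)[d0 ed].
apply: (scalar_exp_shift_inj charF nN annN phiw c0 d0) => x.
by rewrite -ec -ed.
Qed.

Lemma matching_exists : exists c, Sset rho = L @` translate (Sset pi) c.
Proof.
have annNt := alg_iso_annihilator isoL annN.
have [psi psiw rhoE] := scalar_of_projection alg_iso_gen_neq0 annNt hrho.
have [c c0 ec] := scalar_exp_shift charF nN annN phiw (psi := psi \o L) psiw.
by exists c; apply/(matching_scalarP psiw rhoE).
Qed.

(** Existence of a matching point rules out the default value 0 of [cpoint]. *)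
Lemma cpoint_matching : Sset rho = L @` translate (Sset pi) (cpoint L pi rho).
Proof. exact: (xgetPex 0 matching_exists). Qed.

End WithTarget.

Lemma conjugate_projection (L : 'Hom(N, Nt)) c : alg_iso L ->
  admissible_projections Nt (L \o (pi \o mulop (uexp c)) \o L^-1)%VF.
Proof.
move=> isoL; apply: (@projection_of_scalar _ _ _ (L w)
  (phi \o mulop (uexp c) \o L^-1%VF)).
- exact: alg_iso_annihilator.
- by rewrite /= (alg_isoK isoL); exact: translated_scalar_gen.
- by move=> y; rewrite !comp_lfunE /= piE linearZ.
Qed.

End Matching.

Unset Implicit Arguments.

Theorem mainTheorem1 (F : fieldType) (charF : [pchar F] =i pred0)
    (N Nt : commNonunitalAlgType F)
    (hN : admissible N) (hNt : admissible Nt)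
    (hdim : (1 < \dim {:Nt})%N)
    (pi : 'End(N)) (hpi : admissible_projections N pi)
    (pit : 'End(Nt)) (hpit : admissible_projections Nt pit) :
  (forall L : 'Hom(N, Nt),
    (alg_iso L <-> exists c : N, Sset pit = L @` translate (Sset pi) c) /\
    (alg_iso L ->
      unique (fun c : N => Sset pit = L @` translate (Sset pi) c)
             (cpoint L pi pit) /\
      unique (fun c : N => Sset pi c /\
                pit = (L \o (pi \o mulop (uexp c)) \o L^-1)%VF)
             (cpoint L pi pit))) /\
  (forall L : 'Hom(N, Nt), alg_iso L ->
    Sset pi = [set cpoint L pi rho | rho in admissible_projections Nt]).
Proof.
have [[nN /annihilator_line[w w0 annN]] [nNt d1]] := (hN, hNt).
have [phi phiw piE] := scalar_of_projection w0 annN hpi.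
have mP := matchingP charF nN nNt w0 annN phiw piE.
have mI := matching_inj charF nN nNt w0 annN phiw piE.
have cM := cpoint_matching charF nN nNt w0 annN phiw piE.
split=> L; last first.
  move=> isoL; apply/seteqP; split=> [c cS|_ [rho hrho <-]].
    (* The projection attached to [c] is the conjugate of [pi] composed with multiplication by exp
       [c]; uniqueness of the matching point then identifies [c]. *)
    have hrho := conjugate_projection annN phiw piE c isoL.
    eexists; first exact: hrho.
    apply: (mI _ _ hrho isoL); first exact: cM.
    by apply/(mP _ _ hrho isoL).
  by have /(mP _ _ hrho isoL)[] := cM _ _ hrho isoL.
split.
  split=> [isoL|].
    exact: (matching_exists charF nN nNt w0 annN phiw piE hpit isoL).
  exact: (matching_alg_iso charF nN nNt w0 annN phiw piE hpit d1 hdim).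
move=> isoL; have cpM := cM _ _ hpit isoL; split; split=> //.
- by move=> c; apply: (mI _ _ hpit isoL).
- exact/(mP _ _ hpit isoL).
- by move=> c /(mP _ _ hpit isoL); apply: (mI _ _ hpit isoL).
Qed.
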